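(* Let $q,r\in C[a,b]$ be real-valued, and suppose that for some $c>a$ and some $d\ge c$ with $[c,d]\subset(a,b)$ we have $r(x)<0$ on $(a,c)$, $r(x)\equiv 0$ on $[c,d]$, and $r(x)>0$ on $(d,b)$. Let $y=\varphi+i\psi$ be a complex ghost of the non-definite Dirichlet problem $-y''+q(x)y=\lambda r(x)y$, $y(a)=y(b)=0$, where $\varphi={\rm Re}\,y$, $\psi={\rm Im}\,y$. Then the interior zeros of $\varphi$ and $\psi$ (i.e. their zeros in the open interval $(a,b)$) separate one another.
   Context: The problem is called non-definite if each of the quadratic forms $y\mapsto\int_a^b(|y'|^2+q|y|^2)\,dx$ and $y\mapsto\int_a^b r|y|^2\,dx$ takes both positive and negative values on the domain of the Dirichlet problem; it is assumed non-definite and to possess at least one non-real eigenvalue. A complex ghost is a non-trivial eigenfunction $y$ belonging to a non-real eigenvalue $\lambda$; $\lambda$ may be taken with ${\rm Im}\,\lambda>0$ (replace $\lambda,y$ by $\bar\lambda,\bar y$). ''The interior zeros of $\varphi$ and $\psi$ separate one another'' means: between any two consecutive zeros $x_1<x_2$ in $(a,b)$ of one of the two functions (i.e. no further zero of that function lies in $(x_1,x_2)$) there is exactly one zero of the other function, and this zero is distinct from $x_1$ and $x_2$ (so neither $x_1$ nor $x_2$ is a zero of the other function). The case $c=d$ (a single zero of $r$) is allowed. *)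

(* Defs.v *)
From Stdlib Require Import Reals.
From Coquelicot Require Import Coquelicot.
Open Scope R_scope.

Definition Icc (a b x : R) : Prop := a <= x <= b.

(* Derivative relative to [a,b]: two-sided at interior points, one-sided at
   the endpoints; values of f outside [a,b] play no role. *)
Definition is_derive_within (a b : R) (f : R -> C) (x : R) (l : C) : Prop :=
  @filterdiff R_AbsRing (AbsRing_NormedModule R_AbsRing) C_R_NormedModule
    f (within (Icc a b) (locally x)) (fun h : R => scal h l).

Definition C2_within (a b : R) (y y' y'' : R -> C) : Prop :=
  (forall x, Icc a b x -> is_derive_within a b y x (y' x)) /\
  (forall x, Icc a b x -> is_derive_within a b y' x (y'' x)) /\
  @continuous_on R_UniformSpace C_UniformSpace (Icc a b) y''.

(* Since the coefficients are continuous, the domain of the Dirichlet problem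
   is taken to consist of classical, complex-valued C^2 functions. *)
Definition dirichlet_domain (a b : R) (y y' y'' : R -> C) : Prop :=
  C2_within a b y y' y'' /\ y a = RtoC 0 /\ y b = RtoC 0.

Definition energy_form (a b : R) (q : R -> R) (y y' : R -> C) : R :=
  RInt (fun x => Cmod (y' x) ^ 2 + q x * Cmod (y x) ^ 2) a b.

Definition weight_form (a b : R) (r : R -> R) (y : R -> C) : R :=
  RInt (fun x => r x * Cmod (y x) ^ 2) a b.

Definition non_definite (a b : R) (q r : R -> R) : Prop :=
  (exists y y' y'', dirichlet_domain a b y y' y'' /\ 0 < energy_form a b q y y') /\
  (exists y y' y'', dirichlet_domain a b y y' y'' /\ energy_form a b q y y' < 0) /\
  (exists y y' y'', dirichlet_domain a b y y' y'' /\ 0 < weight_form a b r y) /\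
  (exists y y' y'', dirichlet_domain a b y y' y'' /\ weight_form a b r y < 0).

Definition is_eigenfunction (a b : R) (q r : R -> R) (lambda : C) (y : R -> C) : Prop :=
  (exists y' y'',
     dirichlet_domain a b y y' y'' /\
     forall x, Icc a b x -> (- y'' x + q x * y x = lambda * r x * y x)%C) /\
  (exists x, Icc a b x /\ y x <> RtoC 0).

Definition complex_ghost (a b : R) (q r : R -> R) (y : R -> C) : Prop :=
  exists lambda : C, Im lambda <> 0 /\ is_eigenfunction a b q r lambda y.

Definition zeros_separated_by (a b : R) (f g : R -> R) : Prop :=
  forall x1 x2 : R,
    a < x1 -> x1 < x2 -> x2 < b ->
    f x1 = 0 -> f x2 = 0 -> (forall x, x1 < x < x2 -> f x <> 0) ->
    g x1 <> 0 /\ g x2 <> 0 /\ exists! x, x1 < x < x2 /\ g x = 0.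

Definition interior_zeros_separate (a b : R) (f g : R -> R) : Prop :=
  zeros_separated_by a b f g /\ zeros_separated_by a b g f.

(* Main.v *)
(** The Wronskian [W = Re y * (Im y)' - (Re y)' * Im y] vanishes at both
    endpoints and satisfies [W' = - Im lambda * r * |y|^2].  It is therefore
    strictly monotone on [a,c], constant on [c,d] and strictly monotone in the
    opposite direction on [d,b], since [|y|^2] cannot vanish on an interval.
    Hence [W] has no zero in [(a,b)], and the interlacing follows from Rolle's
    theorem applied to the quotients of [Re y] and [Im y]. *)
Require Import Defs.
From Stdlib Require Import Reals Lra.
From Coquelicot Require Import Coquelicot.
Open Scope R_scope.

(** * Mean values and monotone functions *)

Lemma mean_value (f df : R -> R) (l m : R) :
  l < m ->
  (forall x, l < x < m -> is_derive f x (df x)) ->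
  (forall x, l <= x <= m -> continuity_pt f x) ->
  exists x, l < x < m /\ f m - f l = df x * (m - l).
Proof.
  intros Hlm Hd Hc.
  assert (pr : forall x, l < x < m -> derivable_pt f x).
  { intros x Hx; exists (df x); apply is_derive_Reals; auto. }
  destruct (MVT f id l m pr (fun x _ => derivable_pt_id x) Hlm Hc) as [x [P E]].
  { intros; apply derivable_continuous_pt, derivable_pt_id. }
  exists x; split; [exact P|].
  rewrite (derive_pt_eq_0 _ _ _ (pr x P) (proj1 (is_derive_Reals _ _ _) (Hd x P))) in E.
  rewrite derive_pt_id in E; unfold id in E; lra.
Qed.

Lemma is_derive_zero_on (f : R -> R) (l m x df : R) :
  l < x < m -> (forall t, l < t < m -> f t = 0) -> is_derive f x df -> df = 0.
Proof.
  intros Hx Hz Hd.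
  assert (H0 : is_derive f x 0).
  { apply (is_derive_ext_loc (fun _ => 0)).
    - apply (locally_interval _ x l m); simpl; try tauto.
      intros t H1 H2; symmetry; apply Hz; split; assumption.
    - apply @is_derive_const. }
  rewrite <- (is_derive_unique _ _ _ Hd); exact (is_derive_unique _ _ _ H0).
Qed.

(** The mean value theorem on [[l,t]] and on [[t,m]] squeezes [f t] between [f m] and [f l], so [f]
    is constant. The conclusion concerns [df] because the Wronskian's derivative has the solution as
    a factor. *)
Lemma monotone_equal_ends (f df : R -> R) (l m : R) :
  (forall x, l < x < m -> is_derive f x (df x)) ->
  (forall x, l <= x <= m -> continuity_pt f x) ->
  (forall x, l < x < m -> df x <= 0) ->
  f l = f m -> forall x, l < x < m -> df x = 0.
Proof.
  intros Hd Hc Hs He x Hx.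
  apply (is_derive_zero_on (fun t => f t - f l) l m x); [exact Hx| |].
  - intros t Ht.
    destruct (mean_value f df l t) as [u [Hu Eu]]; try tauto;
      try (intros; apply Hd || apply Hc; lra).
    destruct (mean_value f df t m) as [v [Hv Ev]]; try tauto;
      try (intros; apply Hd || apply Hc; lra).
    assert (df u <= 0) by (apply Hs; lra).
    assert (df v <= 0) by (apply Hs; lra).
    nra.
  - replace (df x) with (minus (df x) 0) by (unfold minus, plus, opp; simpl; lra).
    apply (is_derive_minus (V := R_NormedModule) f (fun _ => f l)); [auto | apply @is_derive_const].
Qed.

(** * Uniqueness for the initial value problem *)

Lemma gronwall_zero (E dE : R -> R) (K a b x0 : R) :
  (forall x, a < x < b -> is_derive E x (dE x)) ->
  (forall x, a < x < b -> 0 <= E x) ->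
  (forall x, a < x < b -> Rabs (dE x) <= K * E x) ->
  a < x0 < b -> E x0 = 0 -> forall x, a < x < b -> E x = 0.
Proof.
  intros Hd Hp HK Hx0 E0 x Hx.
  (* Integrating factor: [E u * exp (- K * u)] is nonincreasing, which settles points to the right
     of [x0]; [E u * exp (K * u)] is nondecreasing, which settles those to the left. *)
  assert (D : forall s t, a < t < b ->
    is_derive (fun u => E u * exp (s * u)) t ((dE t + s * E t) * exp (s * t))).
  { intros s t Ht. pose proof (Hd t Ht) as H. auto_derive.
    - exists (dE t); exact H.
    - rewrite (is_derive_unique (fun x : R => E x) _ _ H); ring. }
  assert (C : forall s t, a < t < b -> continuity_pt (fun u => E u * exp (s * u)) t).
  { intros s t Ht. apply continuity_pt_filterlim.
    apply (ex_derive_continuous (fun u => E u * exp (s * u))).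
    eexists; apply D; exact Ht. }
  apply Rle_antisym; [|apply Hp, Hx].
  destruct (Rtotal_order x0 x) as [L | [<- | L]]; [| lra |].
  - destruct (mean_value _ _ x0 x L (fun t Ht => D (- K) t ltac:(lra))
      (fun t Ht => C (- K) t ltac:(lra))) as [u [Hu Eu]].
    rewrite E0 in Eu.
    pose proof (HK u ltac:(lra)) as B; apply Rabs_le_between in B.
    pose proof (exp_pos (- K * u)); pose proof (exp_pos (- K * x)).
    assert ((dE u + - K * E u) * exp (- K * u) <= 0) by nra.
    nra.
  - destruct (mean_value _ _ x x0 L (fun t Ht => D K t ltac:(lra))
      (fun t Ht => C K t ltac:(lra))) as [u [Hu Eu]].
    rewrite E0 in Eu.
    pose proof (HK u ltac:(lra)) as B; apply Rabs_le_between in B.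
    pose proof (exp_pos (K * u)); pose proof (exp_pos (K * x)).
    assert (0 <= (dE u + K * E u) * exp (K * u)) by nra.
    nra.
Qed.

Lemma continuous_bounded (f : R -> R) (a b : R) :
  continuity f -> exists M, forall x, a <= x <= b -> Rabs (f x) <= M.
Proof.
  intros Hf.
  destruct (bounded_continuity (V := R_NormedModule) f a b) as [M HM].
  - intros x _; apply continuity_pt_filterlim, Hf.
  - exists M; intros x Hx; apply Rlt_le, (HM x Hx).
Qed.

(** With [y = u + i v] the system is the single equation [y'' = (p - i s) y]. The energy
    [u^2 + u'^2 + v^2 + v'^2] satisfies a Gronwall inequality and is zero at [x0]. *)
Lemma system_unique (a b : R) (p s u u' v v' : R -> R) :
  continuity p -> continuity s ->
  (forall x, a < x < b -> is_derive u x (u' x)) ->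
  (forall x, a < x < b -> is_derive u' x (p x * u x + s x * v x)) ->
  (forall x, a < x < b -> is_derive v x (v' x)) ->
  (forall x, a < x < b -> is_derive v' x (p x * v x - s x * u x)) ->
  forall x0, a < x0 < b -> u x0 = 0 -> u' x0 = 0 -> v x0 = 0 -> v' x0 = 0 ->
  forall x, a < x < b -> u x = 0 /\ v x = 0.
Proof.
  intros Cp Cs Du Du' Dv Dv' x0 Hx0 U U' V V' x Hx.
  destruct (continuous_bounded p a b Cp) as [P HP].
  destruct (continuous_bounded s a b Cs) as [S HS].
  set (E := fun t => u t * u t + u' t * u' t + v t * v t + v' t * v' t).
  assert (E x = 0) as HE.
  2:{ unfold E in HE; split; nra. }
  apply (gronwall_zero E
    (fun t => 2 * (u t * u' t + u' t * (p t * u t + s t * v t)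
                 + v t * v' t + v' t * (p t * v t - s t * u t)))
    (1 + P + S) a b x0); auto.
  - intros t Ht. unfold E.
    pose proof (Du t Ht) as A1; pose proof (Du' t Ht) as A2;
    pose proof (Dv t Ht) as A3; pose proof (Dv' t Ht) as A4.
    auto_derive.
    + repeat split; eexists; eassumption.
    + rewrite (is_derive_unique (fun x : R => u x) _ _ A1),
        (is_derive_unique (fun x : R => u' x) _ _ A2),
        (is_derive_unique (fun x : R => v x) _ _ A3),
        (is_derive_unique (fun x : R => v' x) _ _ A4); ring.
  - intros t _; unfold E; nra.
  - intros t Ht; unfold E.
    pose proof (HP t ltac:(lra)) as Bp; pose proof (HS t ltac:(lra)) as Bs.
    (* The derivative of [E] consists of six products. The two with coefficient 1, the two with [p]
       and the two with [s] are bounded by [E], [P * E] and [S * E] respectively, whence the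
       constant [1 + P + S]. *)
    assert (Y : forall k M g h, Rabs k <= M -> Rabs (2 * (k * (g * h))) <= M * (g * g + h * h)).
    { intros k M g h Hk.
      replace (2 * (k * (g * h))) with (k * (2 * g * h)) by ring.
      rewrite Rabs_mult; apply Rmult_le_compat; try apply Rabs_pos; auto.
      pose proof (Rle_0_sqr (g + h)); pose proof (Rle_0_sqr (g - h)).
      unfold Rsqr in *; apply Rabs_le; lra. }
    pose proof (Y 1 1 (u t) (u' t) ltac:(rewrite Rabs_R1; lra)) as Y1.
    pose proof (Y 1 1 (v t) (v' t) ltac:(rewrite Rabs_R1; lra)) as Y2.
    pose proof (Y _ _ (u t) (u' t) Bp) as Y3.
    pose proof (Y _ _ (v t) (v' t) Bp) as Y4.
    pose proof (Y _ _ (v t) (u' t) Bs) as Y5.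
    pose proof (Y _ _ (u t) (v' t) Bs) as Y6.
    apply Rabs_le_between in Y1, Y2, Y3, Y4, Y5, Y6.
    apply Rabs_le_between; split; lra.
  - unfold E; rewrite U, U', V, V'; ring.
Qed.

(** * The Wronskian has no interior zero *)

Lemma wronskian_nonzero (a b c d beta : R) (p r u u' v v' : R -> R) :
  a < c -> c <= d -> d < b ->
  (forall x, a < x < c -> r x < 0) ->
  (forall x, c <= x <= d -> r x = 0) ->
  (forall x, d < x < b -> 0 < r x) ->
  beta <> 0 ->
  continuity p -> continuity r ->
  continuity u -> continuity u' -> continuity v -> continuity v' ->
  (forall x, a < x < b -> is_derive u x (u' x)) ->
  (forall x, a < x < b -> is_derive u' x (p x * u x + beta * r x * v x)) ->
  (forall x, a < x < b -> is_derive v x (v' x)) ->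
  (forall x, a < x < b -> is_derive v' x (p x * v x - beta * r x * u x)) ->
  u a = 0 -> v a = 0 -> u b = 0 -> v b = 0 ->
  (exists x, a < x < b /\ (u x <> 0 \/ v x <> 0)) ->
  forall x, a < x < b -> u x * v' x - u' x * v x <> 0.
Proof.
  intros Hac Hcd Hdb Hl Hm Hr Hb Cp Cr Cu Cu' Cv Cv' Du Du' Dv Dv'
    ua va ub vb [z [Hz Nz]].
  set (W := fun x => u x * v' x - u' x * v x).
  set (dW := fun x => - (beta * r x) * (u x * u x + v x * v x)).
  assert (CW : continuity W).
  { intros x. unfold W.
    apply continuity_pt_minus; apply continuity_pt_mult; auto. }
  assert (DW : forall x, a < x < b -> is_derive W x (dW x)).
  { intros x Hx. unfold W, dW.
    pose proof (Du x Hx) as A1; pose proof (Du' x Hx) as A2;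
    pose proof (Dv x Hx) as A3; pose proof (Dv' x Hx) as A4.
    auto_derive.
    + repeat split; eexists; eassumption.
    + rewrite (is_derive_unique (fun x : R => u x) _ _ A1),
        (is_derive_unique (fun x : R => u' x) _ _ A2),
        (is_derive_unique (fun x : R => v x) _ _ A3),
        (is_derive_unique (fun x : R => v' x) _ _ A4); ring. }
  (* The factor [k] fixes the sign so that [k * W] is nonincreasing. Two zeros of [W] then make [dW]
     vanish between them, and since [r] is nonzero there, so do [u] and [v]. *)
  assert (Key : forall k l m, a <= l -> l < m -> m <= b ->
    (forall x, l < x < m -> 0 < k * (beta * r x)) -> W l = 0 -> W m = 0 -> False).
  { intros k l m Hal Hlm Hmb Hk Wl Wm.
    assert (Hzero : forall x, l < x < m -> u x * u x + v x * v x = 0).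
    { intros x Hx.
      assert (k * dW x = 0) as Hd.
      { apply (monotone_equal_ends (fun t => k * W t) (fun t => k * dW t) l m); auto.
        - intros t Ht. apply (is_derive_scal W), DW; lra.
        - intros t _. apply continuity_pt_scal, CW.
        - intros t Ht. pose proof (Hk t Ht). unfold dW.
          assert (0 <= u t * u t + v t * v t) by nra. nra.
        - rewrite Wl, Wm; reflexivity. }
      pose proof (Hk x Hx) as Hkx. unfold dW in Hd. nra. }
    (* Any interior point would do: all four initial values vanish there, so uniqueness contradicts
       the nonzero value at [z]. *)
    set (x0 := (l + m) / 2).
    assert (Hx0 : l < x0 < m) by (unfold x0; lra).
    assert (zu : forall x, l < x < m -> u x = 0) by (intros x Hx; pose proof (Hzero x Hx); nra).
    assert (zv : forall x, l < x < m -> v x = 0) by (intros x Hx; pose proof (Hzero x Hx); nra).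
    destruct (system_unique a b p (fun x => beta * r x) u u' v v') with (x0 := x0) (x := z)
      as [Uz Vz]; auto; try lra.
    - intros x; apply continuity_pt_scal, Cr.
    - apply (is_derive_zero_on u l m x0); auto. apply Du; lra.
    - apply (is_derive_zero_on v l m x0); auto. apply Dv; lra. }
  assert (Wa : W a = 0) by (unfold W; rewrite ua, va; ring).
  assert (Wb : W b = 0) by (unfold W; rewrite ub, vb; ring).
  assert (B2 : 0 < beta * beta) by nra.
  (* The choice [k = - beta] here, and [k = beta] to the right of [d], turns [k * (beta * r)] into a
     positive multiple of [- r] or [r], whatever the sign of [beta]. The point [c] is included
     because the middle interval is reduced to it. *)
  assert (Left : forall x, a < x <= c -> W x <> 0).
  { intros x Hx Wx. apply (Key (- beta) a x); auto; try lra.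
    intros t Ht. assert (r t < 0) by (apply Hl; lra). nra. }
  intros x Hx Wx. change (W x = 0) in Wx.
  destruct (Rle_or_lt x c) as [L | L]; [apply (Left x); tauto|].
  destruct (Rle_or_lt d x) as [G | G].
  - apply (Key beta x b); auto; try lra.
    intros t Ht. assert (0 < r t) by (apply Hr; lra). nra.
  (* Between [c] and [d] the derivative of [W] is zero, so [W x = 0] would give [W c = 0]. *)
  - destruct (mean_value W dW c x L) as [t [Ht Et]].
    + intros t Ht; apply DW; lra.
    + intros; apply CW.
    + apply (Left c); [lra|].
      assert (r t = 0) as Rt by (apply Hm; lra).
      unfold dW in Et; rewrite Rt in Et; lra.
Qed.

(** * Separation of zeros from a nonvanishing Wronskian *)

Lemma wronskian_separates (a b : R) (f f' g g' : R -> R) :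
  (forall x, a < x < b -> is_derive f x (f' x)) ->
  (forall x, a < x < b -> is_derive g x (g' x)) ->
  (forall x, a < x < b -> f x * g' x - f' x * g x <> 0) ->
  zeros_separated_by a b f g.
Proof.
  intros Df Dg HW x1 x2 H1 H12 H2 F1 F2 Fn.
  (* Rolle for [h / k], whose derivative is the Wronskian divided by [k^2]. *)
  assert (Rolle_quotient : forall h h' k k' l m,
    (forall x, a < x < b -> is_derive h x (h' x)) ->
    (forall x, a < x < b -> is_derive k x (k' x)) ->
    (forall x, a < x < b -> h' x * k x - h x * k' x <> 0) ->
    a < l -> l < m -> m < b -> h l = 0 -> h m = 0 ->
    ~ (forall x, l <= x <= m -> k x <> 0)).
  { intros h h' k k' l m Dh Dk HW' Hl Hlm Hm hl hm Hk.
    assert (D : forall x, l <= x <= m ->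
      is_derive (fun t => h t / k t) x ((h' x * k x - h x * k' x) / k x ^ 2)).
    { intros x Hx.
      pose proof (Dh x ltac:(lra)) as A; pose proof (Dk x ltac:(lra)) as B.
      apply is_derive_div; auto. }
    destruct (mean_value (fun t => h t / k t) _ l m Hlm (fun x Hx => D x ltac:(lra)))
      as [x [Hx E]].
    - intros x Hx. apply continuity_pt_filterlim.
      apply (ex_derive_continuous (fun t => h t / k t)).
      eexists; apply D; exact Hx.
    - rewrite hl, hm in E. apply (HW' x); [lra|].
      assert (k x <> 0) as Kx by (apply Hk; lra).
      assert ((h' x * k x - h x * k' x) / k x ^ 2 = 0) as Q.
      { apply (Rmult_eq_reg_r (m - l)); [|lra].
        rewrite <- E. unfold Rdiv. ring. }
      apply (Rmult_eq_reg_r (/ k x ^ 2)).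
      + rewrite Rmult_0_l. exact Q.
      + apply Rinv_neq_0_compat, pow_nonzero, Kx. }
  assert (G1 : g x1 <> 0).
  { intros G; apply (HW x1); [lra|]. rewrite F1, G; ring. }
  assert (G2 : g x2 <> 0).
  { intros G; apply (HW x2); [lra|]. rewrite F2, G; ring. }
  (* Rolle for [g / f]: the denominator is nonzero because [x1] and [x2] are consecutive zeros of
     [f]. *)
  assert (AtMost : forall s t, x1 < s -> s < t -> t < x2 -> g s = 0 -> g t = 0 -> False).
  { intros s t Hs Hst Ht Gs Gt.
    apply (Rolle_quotient g g' f f' s t); auto; try lra.
    - intros x Hx HH; apply (HW x Hx); lra.
    - intros x Hx; apply Fn; lra. }
  repeat split; auto.
  destruct (Classical_Prop.classic (exists x, x1 < x < x2 /\ g x = 0)) as [[x [Hx Gx]] | N].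
  - exists x; repeat split; try tauto.
    intros t [Ht Gt]. destruct (Rtotal_order x t) as [L | [E | L]]; auto; exfalso.
    + apply (AtMost x t); tauto.
    + apply (AtMost t x); tauto.
  (* Without a zero of [g] in between, [f / g] is defined on all of [[x1,x2]] and vanishes at both
     ends. *)
  - exfalso. apply (Rolle_quotient f f' g g' x1 x2); auto; try lra.
    + intros x Hx HH; apply (HW x Hx); lra.
    + intros x Hx Gx.
      destruct (Req_dec x x1) as [-> | N1]; [auto|].
      destruct (Req_dec x x2) as [-> | N2]; [auto|].
      apply N; exists x; split; [lra | exact Gx].
Qed.

(** * From data on [[a,b]] to functions on the whole line *)

Definition clamp (a b x : R) : R := Rmax a (Rmin b x).

Lemma clamp_id (a b x : R) : a <= x <= b -> clamp a b x = x.
Proof.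
  intros Hx; unfold clamp.
  rewrite Rmin_right by lra; apply Rmax_right; lra.
Qed.

Lemma clamp_in (a b x : R) : a <= b -> Icc a b (clamp a b x).
Proof.
  intros Hab; unfold clamp, Icc; split; [apply Rmax_l|].
  apply Rmax_lub; [exact Hab | apply Rmin_l].
Qed.

Lemma clamp_lipschitz (a b x z : R) : Rabs (clamp a b z - clamp a b x) <= Rabs (z - x).
Proof.
  unfold clamp, Rmin.
  destruct (Rle_dec b z), (Rle_dec b x); unfold Rmax;
    repeat destruct Rle_dec; unfold Rabs; repeat destruct Rcase_abs; lra.
Qed.

(** Continuity is given only relative to [[a,b]], whereas the lemmas on the Wronskian ask for
    [continuity] on the line. Composing with the 1-Lipschitz retraction onto [[a,b]] extends [f] by
    its end values. *)
Lemma continuity_clamp (a b : R) (f : R -> R) :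
  a <= b -> continuous_on (Icc a b) f -> continuity (fun x => f (clamp a b x)).
Proof.
  intros Hab Hf x. apply continuity_pt_filterlim.
  apply (filterlim_comp _ _ _ (clamp a b) f _
    (within (Icc a b) (locally (clamp a b x)))).
  - intros P [e He]. exists e. intros z Hz. apply He.
    + apply Rle_lt_trans with (2 := Hz), clamp_lipschitz.
    + apply clamp_in, Hab.
  - apply Hf, clamp_in, Hab.
Qed.

Lemma is_derive_clamp (a b : R) (f : R -> R) (x l : R) :
  a < x < b -> is_derive f x l -> is_derive (fun t => f (clamp a b t)) x l.
Proof.
  intros Hx. apply is_derive_ext_loc, (locally_interval _ x a b); simpl; try tauto.
  intros t H1 H2; rewrite clamp_id; auto; split; apply Rlt_le; auto.
Qed.

Lemma filterlim_within_locally (P : R -> Prop) (x : R) :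
  is_filter_lim (within P (locally x)) x.
Proof.
  intros Q HQ. unfold within. revert HQ. apply filter_imp; auto.
Qed.

Lemma is_derive_within_proj (a b : R) (pr : C -> R) (y : R -> C) (x : R) (l : C) :
  @is_linear R_AbsRing C_R_NormedModule R_NormedModule pr ->
  is_derive_within a b y x l ->
  @filterdiff R_AbsRing R_NormedModule R_NormedModule
    (fun t => pr (y t)) (within (Icc a b) (locally x)) (fun h => scal h (pr l)).
Proof.
  intros Hpr H.
  assert (FF : Filter (within (Icc a b) (locally x))) by apply within_filter, locally_filter.
  eapply filterdiff_ext_lin.
  - apply (filterdiff_comp (U := R_NormedModule) (V := C_R_NormedModule)
      (W := R_NormedModule) y pr _ pr H).
    apply filterdiff_linear, Hpr.
  - intros h.
    exact (@linear_scal R_AbsRing C_R_NormedModule R_NormedModule pr Hpr h l).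
Qed.

Lemma filterdiff_within_interior (a b : R) (f : R -> R) (x l : R) :
  a < x < b ->
  @filterdiff R_AbsRing R_NormedModule R_NormedModule
    f (within (Icc a b) (locally x)) (fun h => scal h l) ->
  is_derive f x l.
Proof.
  intros Hx [Hl Hd]. split; [exact Hl|].
  intros z Hz. assert (z = x) as ->.
  { symmetry. apply (is_filter_lim_locally_unique x z Hz). }
  intros eps.
  pose proof (Hd x (filterlim_within_locally _ x) eps) as H. unfold within in H.
  assert (locally x (Icc a b)) as HI.
  { apply (locally_interval _ x a b); simpl; try tauto.
    intros t H1 H2; split; apply Rlt_le; auto. }
  generalize (filter_and _ _ H HI). apply filter_imp. tauto.
Qed.

(** Serves [Re] and [Im], for [y] and for [y']. One-sided differentiability gives continuity up to
    the endpoints, where the Wronskian is known to vanish; two-sided derivatives are obtained inside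
    only. *)
Lemma C1_proj (a b : R) (pr : C -> R) (y y' : R -> C) :
  a <= b ->
  @is_linear R_AbsRing C_R_NormedModule R_NormedModule pr ->
  (forall x, Icc a b x -> is_derive_within a b y x (y' x)) ->
  continuity (fun x => pr (y (clamp a b x))) /\
  forall x, a < x < b -> is_derive (fun t => pr (y t)) x (pr (y' x)).
Proof.
  intros Hab Hpr H. split.
  - apply (continuity_clamp a b (fun x => pr (y x)) Hab). intros x Hx.
    apply (filterdiff_continuous_aux (K := R_AbsRing) (U := R_NormedModule)
      (V := R_NormedModule) (F := within (Icc a b) (locally x)) (fun t => pr (y t))).
    + eexists; apply is_derive_within_proj; [exact Hpr | apply H, Hx].
    + apply filterlim_within_locally.
  - intros x Hx. apply (filterdiff_within_interior a b _ x _ Hx).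
    apply is_derive_within_proj; [exact Hpr | apply H; split; lra].
Qed.

Lemma is_linear_Re : @is_linear R_AbsRing C_R_NormedModule R_NormedModule Re.
Proof. exact (@is_linear_fst R_AbsRing R_NormedModule R_NormedModule). Qed.

Lemma is_linear_Im : @is_linear R_AbsRing C_R_NormedModule R_NormedModule Im.
Proof. exact (@is_linear_snd R_AbsRing R_NormedModule R_NormedModule). Qed.

(** * Real and imaginary parts of the ghost *)

Theorem theorem2 :
  forall (a b c d : R) (q r : R -> R),
    a < c -> c <= d -> d < b ->
    continuous_on (Icc a b) q ->
    continuous_on (Icc a b) r ->
    (forall x, a < x < c -> r x < 0) ->
    (forall x, c <= x <= d -> r x = 0) ->
    (forall x, d < x < b -> 0 < r x) ->
    non_definite a b q r ->
    forall y : R -> C,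
      complex_ghost a b q r y ->
      interior_zeros_separate a b (fun x => Re (y x)) (fun x => Im (y x)).
Proof.
  intros a b c d q r Hac Hcd Hdb Cq Cr Hl Hm Hr _ y
    [lambda [Hlam [[y' [y'' [[[D1 [D2 _]] [ya yb]] Heq]]] [z [Hz Nz]]]]].
  assert (Hab : a <= b) by lra.
  destruct (C1_proj a b Re y y' Hab is_linear_Re D1) as [Cu Du].
  destruct (C1_proj a b Im y y' Hab is_linear_Im D1) as [Cv Dv].
  destruct (C1_proj a b Re y' y'' Hab is_linear_Re D2) as [Cu' Du'].
  destruct (C1_proj a b Im y' y'' Hab is_linear_Im D2) as [Cv' Dv'].
  pose proof (continuity_clamp a b q Hab Cq) as Kq.
  pose proof (continuity_clamp a b r Hab Cr) as Kr.
  assert (W : forall x, a < x < b -> Re (y x) * Im (y' x) - Re (y' x) * Im (y x) <> 0).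
  { intros x Hx.
    rewrite <- (clamp_id a b x) by lra.
    (* The equation reads [y'' = (q - lambda * r) * y], so [p = q - Re lambda * r] and the coupling
       coefficient is [Im lambda * r]. *)
    apply (wronskian_nonzero a b c d (Im lambda)
      (fun t => q (clamp a b t) - Re lambda * r (clamp a b t))
      (fun t => r (clamp a b t))
      (fun t => Re (y (clamp a b t))) (fun t => Re (y' (clamp a b t)))
      (fun t => Im (y (clamp a b t))) (fun t => Im (y' (clamp a b t)))); auto.
    - intros t Ht; rewrite clamp_id by lra; auto.
    - intros t Ht; rewrite clamp_id by lra; auto.
    - intros t Ht; rewrite clamp_id by lra; auto.
    - intros t; apply continuity_pt_minus; [apply Kq|].
      apply continuity_pt_scal, Kr.
    - intros t Ht; apply (is_derive_clamp a b (fun s => Re (y s))); auto.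
      rewrite clamp_id by lra; auto.
    - intros t Ht; apply (is_derive_clamp a b (fun s => Re (y' s))); auto.
      rewrite clamp_id by lra.
      replace (_ + _) with (Re (y'' t)); auto.
      pose proof (f_equal Re (Heq t ltac:(split; lra))) as E.
      unfold Re, Im, Cplus, Copp, Cmult, RtoC in *; simpl in *; lra.
    - intros t Ht; apply (is_derive_clamp a b (fun s => Im (y s))); auto.
      rewrite clamp_id by lra; auto.
    - intros t Ht; apply (is_derive_clamp a b (fun s => Im (y' s))); auto.
      rewrite clamp_id by lra.
      replace (_ - _) with (Im (y'' t)); auto.
      pose proof (f_equal Im (Heq t ltac:(split; lra))) as E.
      unfold Re, Im, Cplus, Copp, Cmult, RtoC in *; simpl in *; lra.
    - rewrite clamp_id, ya by lra; reflexivity.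
    - rewrite clamp_id, ya by lra; reflexivity.
    - rewrite clamp_id, yb by lra; reflexivity.
    - rewrite clamp_id, yb by lra; reflexivity.
    (* The boundary conditions keep the point where [y] is nonzero away from [a] and [b]. *)
    - exists z. unfold Icc in Hz.
      assert (z <> a) by (intros ->; auto).
      assert (z <> b) by (intros ->; auto).
      split; [lra|]. rewrite clamp_id by lra.
      destruct (Req_dec (Re (y z)) 0) as [Z1 | Z1]; [|auto].
      right; intros Z2; apply Nz.
      unfold Re, Im in *; rewrite (surjective_pairing (y z)), Z1, Z2; reflexivity. }
  split.
  - apply wronskian_separates with (f' := fun x => Re (y' x)) (g' := fun x => Im (y' x)); auto.
  (* Exchanging the two parts only changes the sign of the Wronskian. *)
  - apply wronskian_separates with (f' := fun x => Im (y' x)) (g' := fun x => Re (y' x)); auto.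
    intros x Hx E; apply (W x Hx); lra.
Qed.
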